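(* Let $m\le n$ be positive integers and let $\kappa(m,n)$ be as defined in the context. Then: (i) $\kappa(m,m)=1$ for every positive integer $m$; (ii) $\kappa(m+1,n+1)\le \kappa(m,n)\le \kappa(m,n+1)$; (iii) $\kappa(1,2)=2$, and $\kappa(m,m+1)=1$ for every integer $m\ge 2$.
   Context: A $\mathbb{Z}$-lattice means a free $\mathbb{Z}$-module of finite rank with a positive definite symmetric bilinear form $B$ taking integer values (positive definite and integral); $Q(x)=B(x,x)$. A $\mathbb{Z}$-lattice $\ell$ is represented by a $\mathbb{Z}$-lattice $L$ if there is a linear map $\sigma:\ell\to L$ with $B(\sigma x,\sigma y)=B(x,y)$ for all $x,y\in\ell$. A $\mathbb{Z}$-lattice is $m$-universal if it represents every $\mathbb{Z}$-lattice of rank $m$; $u_{\mathbb{Z}}(m)$ is the minimal rank of an $m$-universal $\mathbb{Z}$-lattice. For positive integers $m\le n$, $\kappa(m,n)$ is the largest integer $k$ such that for any $\mathbb{Z}$-lattices $\ell_1,\dots,\ell_k$ of rank $m$ there is a $\mathbb{Z}$-lattice of rank $n$ representing every $\ell_i$; if $n\ge u_{\mathbb{Z}}(m)$ one sets $\kappa(m,n)=\infty$ (inequalities are understood in $\mathbb{Z}\cup\{\infty\}$). *)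

(* Defs.v *)
From HB Require Import structures.
From mathcomp Require Import all_boot all_order all_algebra.
From mathcomp Require Import boolp classical_sets constructive_ereal.

Set Implicit Arguments.
Unset Strict Implicit.
Unset Printing Implicit Defensive.

Import Order.TTheory GRing.Theory Num.Theory.

Local Open Scope ring_scope.
Local Open Scope classical_set_scope.

Definition is_zbasis (V : zmodType) (n : nat) (b : 'I_n -> V) : Prop :=
  bijective (fun c : 'rV[int]_n => \sum_(i < n) b i *~ c 0 i).

(* A Z-module is the same thing as an abelian group, so Z-linearity is
   additivity.  The field [rank] is determined by the carrier, because all
   Z-bases of a free Z-module of finite rank have the same size. *)
Record zlattice := ZLattice {
  carrier :> zmodType;
  rank : nat;
  form : carrier -> carrier -> int;
  zlattice_free : exists b : 'I_rank -> carrier, is_zbasis b;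
  formDl : forall x y z, form (x + y) z = form x z + form y z;
  formDr : forall x y z, form x (y + z) = form x y + form x z;
  form_sym : forall x y, form x y = form y x;
  form_posdef : forall x, x != 0 -> 0 < form x x
}.

Definition represents (L l : zlattice) : Prop :=
  exists s : {additive l -> L}, forall x y, form (s x) (s y) = form x y.

Definition universal (m : nat) (L : zlattice) : Prop :=
  forall l : zlattice, rank l = m -> represents L l.

Definition universal_ranks (m : nat) : set nat :=
  [set r | exists2 L : zlattice, rank L = r & universal m L].

(* Minimal rank of an m-universal lattice; the default +oo is returned only if
   there is no m-universal lattice at all. *)
Definition u_Z (m : nat) : \bar int :=
  xget +oo%E [set (r%:Z)%:E | r in
    [set r | universal_ranks m r /\
             forall s, universal_ranks m s -> (r <= s)%N]].

Definition simultaneously_representable (m n : nat) : set nat :=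
  [set k | forall l : 'I_k -> zlattice, (forall i, rank (l i) = m) ->
     exists2 L : zlattice, rank L = n & forall i, represents L (l i)].

(* For m <= n the set [simultaneously_representable m n] is nonempty, so in the
   second branch the default +oo is returned only if it is unbounded. *)
Definition kappa (m n : nat) : \bar int :=
  if `[< (u_Z m <= (n%:Z)%:E)%E >] then +oo%E
  else xget +oo%E [set (k%:Z)%:E | k in
    [set k | simultaneously_representable m n k /\
             forall j, simultaneously_representable m n j -> (j <= k)%N]].

(* Main.v *)
(* In terms of Gram matrices, write S(m, n) for the set of k such that any k
   forms of rank m are represented by one form of rank n; it is an initial
   segment of the naturals whose supremum is kappa(m, n).  Adding an orthogonal
   summand <1> to L gives S(m, n) <= S(m, n+1).  Conversely, adding <1> to every
   l_i forces a splitting L = <1> + L', and any two unit vectors of L are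
   exchanged up to sign by an isometry, so that L' represents every l_i:
   S(m+1, n+1) <= S(m, n).  It remains to see that no unary form represents both
   1 and 2, no binary form represents 1, 2 and 7, and no ternary form represents
   both <1, 1> and <3, 3>. *)
Require Import Defs.
From mathcomp Require Import all_boot all_order all_algebra.
From mathcomp Require Import boolp classical_sets constructive_ereal.
From HB Require Import structures.
From mathcomp Require Import zify.

Set Implicit Arguments.
Unset Strict Implicit.
Unset Printing Implicit Defensive.

Import Order.TTheory GRing.Theory Num.Theory.
Import Defs.

Local Open Scope ring_scope.

(** * Gram matrices and the lattices they encode *)

Definition posdef n (G : 'M[int]_n) : Prop :=
  G^T = G /\ forall x : 'rV_n, x != 0 -> 0 < (x *m G *m x^T) 0 0.

Definition mrep n m (H : 'M[int]_n) (G : 'M[int]_m) : Prop :=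
  exists X : 'M[int]_(m, n), X *m H *m X^T = G.

Section Form.
Variable L : zlattice.

Lemma form_is_zmod_morphism (x : L) : zmod_morphism (form x).
Proof.
move=> y z; apply/eqP; rewrite eq_sym subr_eq -formDr.
by rewrite addrNK.
Qed.

HB.instance Definition _ (x : L) :=
  GRing.isZmodMorphism.Build L int (form x) (form_is_zmod_morphism x).

Definition comb n (b : 'I_n -> L) (c : 'rV[int]_n) : L :=
  \sum_(i < n) b i *~ c 0 i.

Definition gram n (b : 'I_n -> L) : 'M[int]_n := \matrix_(i, j) form (b i) (b j).

Lemma comb_is_zmod_morphism n (b : 'I_n -> L) : zmod_morphism (comb b).
Proof.
move=> x y; rewrite /comb -sumrB; apply: eq_bigr => i _.
by rewrite !mxE mulrzBr.
Qed.

HB.instance Definition _ n (b : 'I_n -> L) :=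
  GRing.isZmodMorphism.Build _ L (comb b) (comb_is_zmod_morphism b).

Lemma form_comb n (b : 'I_n -> L) (x y : 'rV_n) :
  form (comb b x) (comb b y) = (x *m gram b *m y^T) 0 0.
Proof.
rewrite mxE [RHS](eq_bigr (fun j => \sum_i x 0 i * form (b i) (b j) * y 0 j)).
  rewrite raddf_sum; apply: eq_bigr => j _.
  rewrite raddfMz /= form_sym raddf_sum -mulrzr mulr_suml; apply: eq_bigr => i _.
  by rewrite raddfMz /= form_sym -mulrzr !intz mulrC; lia.
by move=> j _; rewrite !mxE mulr_suml; apply: eq_bigr => i _; rewrite !mxE.
Qed.

Lemma gram_posdef n (b : 'I_n -> L) : is_zbasis b -> posdef (gram b).
Proof.
move=> /bij_inj b_inj; split; first by apply/matrixP=> i j; rewrite !mxE form_sym.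
move=> x x0; rewrite -form_comb; apply: form_posdef; apply: contra_neq x0.
by move=> cx0; apply: b_inj; rewrite -/(comb b x) cx0 -/(comb b 0) raddf0.
Qed.

End Form.

Lemma mulmx_trE n m (G : 'M[int]_n) (X : 'M_(m, n)) i j :
  (X *m G *m X^T) i j = (row i X *m G *m (row j X)^T) 0 0.
Proof.
rewrite tr_row -!row_mul !mxE; apply: eq_bigr => k _.
by rewrite !mxE.
Qed.

(** A map [s] and a matrix [X] determine each other: row [i] of [X] holds the coordinates of
    [s (b i)] in the basis [bL]. *)
Lemma representsP (L l : zlattice) n m (bL : 'I_n -> L) (b : 'I_m -> l) :
  is_zbasis bL -> is_zbasis b -> represents L l <-> mrep (gram bL) (gram b).
Proof.
move=> [gL gLK bLK] [g gK bK]; split=> [[s sP] | [X XP]].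
  exists (\matrix_i gL (s (b i))); apply/matrixP=> i j.
  by rewrite mulmx_trE !rowK -form_comb /comb !bLK sP mxE.
(* The coordinate map [g] inverts the additive bijection [comb b], hence is itself additive. *)
have g_add : zmod_morphism g.
  move=> x y; apply: (can_inj gK); rewrite bK.
  by rewrite -/(comb b _) raddfB /= /comb !bK.
pose f x := comb bL (g x *m X).
have f_add : zmod_morphism f by move=> x y; rewrite /f g_add mulmxBl raddfB.
pose F : {additive l -> L} := HB.pack f (GRing.isZmodMorphism.Build _ _ f f_add).
exists F => x y; rewrite /= /f form_comb trmx_mul.
have -> : g x *m X *m gram bL *m (X^T *m (g y)^T) =
   g x *m (X *m gram bL *m X^T) *m (g y)^T by rewrite !mulmxA.
by rewrite XP -form_comb /comb !bK.
Qed.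

Section GramLattice.
Variables (n : nat) (G : 'M[int]_n) (Gpd : posdef G).

Let gform (x y : 'rV[int]_n) : int := (x *m G *m y^T) 0 0.

Lemma delta_basis : is_zbasis (fun i : 'I_n => delta_mx 0 i : 'rV[int]_n).
Proof.
have eqid (c : 'rV[int]_n) : \sum_(i < n) delta_mx 0 i *~ c 0 i = c.
  rewrite [RHS]row_sum_delta; apply: eq_bigr => i _.
  by rewrite -scaler_int intz.
by exists id => c; rewrite eqid.
Qed.

Fact gform_sym x y : gform x y = gform y x.
Proof.
rewrite /gform; have -> : x *m G *m y^T = (y *m G *m x^T)^T.
  by rewrite !trmx_mul trmxK Gpd.1 mulmxA.
by rewrite mxE.
Qed.

Fact gformDl x y z : gform (x + y) z = gform x z + gform y z.
Proof. by rewrite /gform !mulmxDl mxE. Qed.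

Fact gformDr x y z : gform x (y + z) = gform x y + gform x z.
Proof. by rewrite ![gform x _]gform_sym gformDl. Qed.

Definition gram_lattice : zlattice :=
  ZLattice (ex_intro _ _ delta_basis) gformDl gformDr gform_sym Gpd.2.

Lemma gram_latticeP :
  exists2 b : 'I_n -> gram_lattice, is_zbasis b & gram b = G.
Proof.
exists (fun i => delta_mx 0 i : 'rV_n); first exact: delta_basis.
apply/matrixP=> i j; rewrite mxE /= /gform -rowE trmx_delta -colE.
by rewrite !mxE.
Qed.

End GramLattice.

Definition mx_simul m n k : Prop :=
  forall G : 'I_k -> 'M[int]_m, (forall i, posdef (G i)) ->
    exists2 H : 'M[int]_n, posdef H & forall i, mrep H (G i).

Lemma simulP m n k : simultaneously_representable m n k <-> mx_simul m n k.
Proof.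
split=> [lS G Gpd | mxS l lm].
  have [L Ln Lrep] := lS (fun i => gram_lattice (Gpd i)) (fun=> erefl).
  move: Ln; have [b bP] := zlattice_free L => Ln.
  rewrite -Ln; exists (gram b); first exact: gram_posdef.
  move=> i; have [b' b'P b'G] := gram_latticeP (Gpd i).
  by have /(representsP bP b'P) := Lrep i; rewrite b'G.
(* A basis of [l i] is indexed by [rank (l i)], so its Gram matrix has size [m] only after rewriting
   with [lm i]. Keeping just the matrix and the implication hides the basis from the choice. *)
have /choice[G GP] i : exists G : 'M_m, posdef G /\
    forall (L : zlattice) (b : 'I_n -> L), is_zbasis b ->
      mrep (gram b) G -> represents L (l i).
  have [b bP] := zlattice_free (l i); move: b bP; rewrite (lm i) => b bP.
  exists (gram b); split; first exact: gram_posdef.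
  by move=> L b' b'P /(representsP b'P bP).
have [i|H Hpd HG] := mxS G; first by case: (GP i).
exists (gram_lattice Hpd) => // i; have [b bP bH] := gram_latticeP Hpd.
by apply: (GP i).2 bP _; rewrite bH.
Qed.

Lemma universal_simul m k (L : zlattice) :
  universal m L -> simultaneously_representable m (rank L) k.
Proof. by move=> Luniv l lm; exists L => // i; apply: Luniv. Qed.

(** * Orthogonal sums with <1>: splitting and cancellation *)

Lemma mrep_refl n (H : 'M[int]_n) : mrep H H.
Proof. by exists 1%:M; rewrite mul1mx trmx1 mulmx1. Qed.

Lemma mrep_trans n m p (H : 'M[int]_n) (G : 'M[int]_m) (K : 'M[int]_p) :
  mrep K H -> mrep H G -> mrep K G.
Proof.
by move=> [X <-] [Y <-]; exists (Y *m X); rewrite trmx_mul !mulmxA.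
Qed.

Lemma posdef_mul m n (H : 'M[int]_n) (N : 'M[int]_(m, n)) :
  posdef H -> (forall z : 'rV_m, z *m N = 0 -> z = 0) -> posdef (N *m H *m N^T).
Proof.
move=> [Hsym Hpos] Ninj; split; first by rewrite !trmx_mul trmxK Hsym mulmxA.
move=> x x0; rewrite !mulmxA -[_ *m N^T *m x^T]mulmxA -trmx_mul.
by apply: Hpos; apply: contra_neq x0 => /Ninj.
Qed.

Definition osum1 n (G : 'M[int]_n) : 'M[int]_(1 + n) := block_mx 1%:M 0 0 G.

Lemma osum1_mul n p q (G : 'M[int]_n) (a : 'cV_p) (x : 'M_(p, n))
    (c : 'cV_q) (y : 'M_(q, n)) :
  row_mx a x *m osum1 G *m (row_mx c y)^T = a *m c^T + x *m G *m y^T.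
Proof.
by rewrite mul_row_block tr_row_mx mul_row_col !mulmx0 addr0 add0r mulmx1.
Qed.

Lemma posdef_osum1 n (G : 'M[int]_n) : posdef G -> posdef (osum1 G).
Proof.
move=> [Gsym Gpos]; split; first by rewrite tr_block_mx trmx1 !trmx0 Gsym.
move=> x; rewrite -[x]hsubmxK; set a := lsubmx _; set y := rsubmx _ => x0.
rewrite osum1_mul mxE [X in X + _]mxE big_ord1 [X in _ * X + _]mxE -expr2.
have [y0|/Gpos y_gt0] := eqVneq y 0; last by rewrite ltr_wpDl ?sqr_ge0.
rewrite y0 !mul0mx [X in _ + X]mxE addr0 exprn_even_gt0 //=.
apply: contra_neq x0 => a0; rewrite y0 (_ : a = 0) ?row_mx0 //.
by apply/matrixP=> i j; rewrite !ord1 a0 mxE.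
Qed.

Lemma mrep_osum1_l n (H : 'M[int]_n) : mrep (osum1 H) H.
Proof.
exists (row_mx 0 1%:M); rewrite mul_row_block tr_row_mx mul_row_col.
by rewrite !mul0mx !add0r !mul1mx trmx1 trmx0 mulmx0 add0r mulmx1.
Qed.

(** In the Smith form [w = P *m D *m R] the column [D] has a single nonzero entry, at the top. So
    [Y *m w = 0] means that the first column of [Y *m P] vanishes, and the last [n] rows of
    [invmx P] are a Z-basis of the kernel of [w]. *)
Lemma orthogonal_basis n (w : 'cV[int]_(1 + n)) : w != 0 ->
  exists N : 'M[int]_(n, 1 + n),
    [/\ forall z : 'rV_n, z *m N = 0 -> z = 0, N *m w = 0 &
        forall m (Y : 'M[int]_(m, 1 + n)), Y *m w = 0 -> exists Z, Y = Z *m N].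
Proof.
move=> w0; have [P Pu [R Ru [d _]]] := int_Smith_normal_form w.
set D := (\matrix_(_, _) _) => wE.
have DE : D = col_mx (d`_0)%:M 0.
  by apply/matrixP=> i j; rewrite !ord1 -[i]splitK; case: split => k;
    rewrite ?col_mxEu ?col_mxEd !mxE //= ord1.
have d0 : d`_0 != 0.
  apply: contra_neq w0 => d0; rewrite wE DE d0 (_ : 0%:M = 0) ?col_mx0.
    by rewrite mulmx0 mul0mx.
  by apply/matrixP=> i j; rewrite !mxE mul0rn.
exists (dsubmx (invmx P)); split=> [z zN||m Y].
- have : row_mx 0 z *m invmx P = 0.
    by rewrite -[invmx P]vsubmxK mul_row_col mul0mx add0r.
  move/(congr1 (mulmx^~ P)); rewrite mulmxKV // mul0mx -[RHS]row_mx0.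
  by case/eq_row_mx.
- by rewrite mul_dsub_mx wE !mulmxA mulVmx // mul1mx DE mul_col_mx mul0mx col_mxKd.
rewrite wE !mulmxA => /(congr1 (mulmx^~ (invmx R))); rewrite mulmxK // mul0mx.
rewrite DE -[Y *m P]hsubmxK mul_row_col mulmx0 addr0 mul_mx_scalar => YP0.
exists (rsubmx (Y *m P)); rewrite -[LHS](mulmxK Pu) -[Y *m P in LHS]hsubmxK.
rewrite -[X in _ *m X = _]vsubmxK mul_row_col (_ : lsubmx _ = 0) ?mul0mx ?add0r //.
apply/matrixP=> i j; move/matrixP/(_ i j): YP0; rewrite !mxE => /eqP.
by rewrite mulf_eq0 (negPf d0) => /eqP.
Qed.

(** Since [u] has norm 1, the projection of any vector onto [u] has an integral coefficient, so the
    lattice is the sum of the line of [u] and its orthogonal complement. *)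
Lemma posdef_unit_split n (H : 'M[int]_(1 + n)) (u : 'rV_(1 + n)) :
  posdef H -> u *m H *m u^T = 1%:M ->
  exists2 H' : 'M[int]_n, posdef H' & mrep (osum1 H') H.
Proof.
move=> Hpd u1; have u0 : H *m u^T != 0.
  apply: contra_eq_neq u1 => Hu0; rewrite -mulmxA Hu0 mulmx0.
  by rewrite eq_sym oner_neq0.
have [N [Ninj Nu NP]] := orthogonal_basis u0.
have uN : u *m H *m N^T = 0.
  have -> : u *m H *m N^T = (N *m (H *m u^T))^T by rewrite !trmx_mul trmxK Hpd.1.
  by rewrite Nu trmx0.
exists (N *m H *m N^T); first exact: posdef_mul.
(* The entries of [c] are the products of the basis vectors with [u], so [1%:M - c *m u] projects
   onto the complement; then [row_mx c Z] is a left inverse of [col_mx u N]. *)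
pose c := H *m u^T; have [|Z ZE] := NP _ (1%:M - c *m u).
  rewrite mulmxBl mul1mx -!mulmxA -/c [u *m _]mulmxA u1.
  by rewrite mulmx1 subrr.
exists (row_mx c Z); rewrite /osum1.
have -> : block_mx 1%:M 0 0 (N *m H *m N^T) = col_mx u N *m H *m (col_mx u N)^T.
  rewrite tr_col_mx mul_col_mx mul_col_row u1 uN.
  by rewrite -[N *m H *m u^T]mulmxA Nu.
rewrite !mulmxA -[_ *m _^T *m _^T]mulmxA -trmx_mul mul_row_col -ZE addrC.
by rewrite subrK trmx1 mul1mx mulmx1.
Qed.

(* The image [row_mx a x] of the unit vector [e] has norm 1: either it is [e] or
   [-e], or it is orthogonal to [e], and then the reflection in their difference
   sends it to [e] and turns the image [row_mx c Z] of the complement into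
   [row_mx 0 (Z + c *m x)]. *)
Lemma osum1_cancel n m (H : 'M[int]_n) (G : 'M[int]_m) :
  posdef H -> mrep (osum1 H) (osum1 G) -> mrep H G.
Proof.
move=> Hpd [X]; rewrite -[X]vsubmxK.
set v := usubmx X; set Y := dsubmx X.
rewrite tr_col_mx mul_col_mx mul_col_row => /eq_block_mx[vv vY _ YY].
move: vv vY YY; rewrite -[v]hsubmxK -[Y]hsubmxK.
move: (lsubmx v) (rsubmx v) (lsubmx Y) (rsubmx Y) => a x c Z.
rewrite !osum1_mul => vv vY YY.
have aE : a = (a 0 0)%:M by apply/matrixP=> i j; rewrite !ord1 !mxE.
have ax1 : a 0 0 ^+ 2 + (x *m H *m x^T) 0 0 = 1.
  by move/matrixP/(_ 0 0): vv; rewrite aE !mxE !big_ord1 !mxE /= mulr1n.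
have [x0|/Hpd.2 x_gt0] := eqVneq x 0.
  have a0 : a 0 0 != 0.
    by apply: contra_eq_neq ax1 => ->; rewrite x0 !mul0mx mxE.
  have c0 : c = 0.
    move: vY; rewrite x0 !mul0mx addr0 aE mul_scalar_mx => /matrixP vY.
    apply/matrixP=> i j; move/eqP: (vY j i); rewrite !mxE mulf_eq0 (negPf a0).
    by move/eqP.
  by exists Z; rewrite -YY c0 mul0mx add0r.
have a0 : a = 0.
  rewrite aE; have -> : a 0 0 = 0.
    apply/eqP; rewrite -sqrf_eq0 eq_le sqr_ge0 andbT.
    by rewrite -ltzD1 add0r -ax1 ltrDl.
  by apply/matrixP=> i j; rewrite !mxE mul0rn.
move: vv vY; rewrite a0 !mul0mx !add0r => xx xZ.
have Zx : Z *m H *m x^T = 0.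
  have -> : Z *m H *m x^T = (x *m H *m Z^T)^T.
    by rewrite !trmx_mul trmxK Hpd.1 mulmxA.
  by rewrite xZ trmx0.
exists (Z + c *m x); rewrite linearD /= trmx_mul !mulmxDl !mulmxDr !mulmxA.
have cxH p (W : 'M_(n, p)) : c *m x *m H *m W = c *m (x *m H *m W).
  by rewrite !mulmxA.
by rewrite Zx mul0mx addr0 !cxH xZ xx mulmx0 mulmx1 add0r addrC.
Qed.

(** * Monotonicity of the sets S(m, n) *)

Lemma diag_posdef n (d : 'rV[int]_n) :
  (forall i, 0 < d 0 i) -> posdef (diag_mx d).
Proof.
move=> d_gt0; split=> [|x x0]; first by rewrite tr_diag_mx.
have -> : (x *m diag_mx d *m x^T) 0 0 = \sum_i d 0 i * x 0 i ^+ 2.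
  rewrite mxE; apply: eq_bigr => i _; rewrite mul_mx_diag !mxE.
  by rewrite expr2 mulrCA mulrA.
have [i xi] : exists i, x 0 i != 0 by apply/rV0Pn.
rewrite (bigD1 i) //=; apply: ltr_pwDl.
  by apply: mulr_gt0 => //; rewrite exprn_even_gt0.
by apply: sumr_ge0 => j _; apply: mulr_ge0; [exact: ltW|exact: sqr_ge0].
Qed.

Lemma scalar_posdef n (d : int) : 0 < d -> posdef (d%:M : 'M_n).
Proof.
by move=> d0; rewrite -diag_const_mx; apply: diag_posdef => i; rewrite mxE.
Qed.

Lemma mx_simul0 m n : mx_simul m n 0.
Proof. by move=> G _; exists 1%:M => [|[]//]; apply: scalar_posdef. Qed.

Lemma mx_simul1 m : mx_simul m m 1.
Proof.
by move=> G Gpd; exists (G 0) => // i; rewrite ord1; apply: mrep_refl.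
Qed.

Lemma mx_simulS m n k : mx_simul m n k -> mx_simul m n.+1 k.
Proof.
move=> mxS G /mxS[H Hpd HG]; exists (osum1 H); first exact: posdef_osum1.
by move=> i; apply: mrep_trans (mrep_osum1_l H) _.
Qed.

Lemma mx_simul_leq m n n' k : (n <= n')%N -> mx_simul m n k -> mx_simul m n' k.
Proof.
move=> /subnKC <-; elim: (n' - n)%N => [|j IHj]; first by rewrite addn0.
by move=> /IHj; rewrite addnS; apply: mx_simulS.
Qed.

Lemma mx_simul_geq m n j k : (j <= k)%N -> mx_simul m n k -> mx_simul m n j.
Proof.
move=> jk mxS G Gpd.
(* The family is padded with identity matrices up to length [k]. *)
pose f (i : 'I_k) : 'M_m :=
  if insub (val i) is Some i' then G i' else 1%:M.
have [|H Hpd HG] := mxS f.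
  by move=> i; rewrite /f; case: insubP => [i' _ _ //|_]; apply: scalar_posdef.
exists H => // i; have := HG (widen_ord jk i).
by rewrite /f insubT //= => ?; rewrite (_ : Sub _ _ = i) //; apply: val_inj.
Qed.

Lemma mrep_osum1_unit n m (H : 'M[int]_n) (G : 'M[int]_m) :
  mrep H (osum1 G) -> exists u : 'rV_n, u *m H *m u^T = 1%:M.
Proof.
move=> [X]; rewrite -[X]vsubmxK tr_col_mx mul_col_mx mul_col_row.
by case/eq_block_mx=> u1 _ _ _; exists (usubmx X).
Qed.

Lemma mx_simul_pred m n k : mx_simul m.+1 n.+1 k -> mx_simul m n k.
Proof.
(* An empty family forces no unit vector in [H], so it is treated apart. *)
case: k => [|k] mxS G Gpd; first exact: mx_simul0.
have [|H Hpd HG] := mxS (fun i => osum1 (G i)).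
  by move=> i; apply: (@posdef_osum1 m).
(* The unit vector comes from the first form alone; by cancellation the resulting complement
   represents all the other forms too. *)
have [u u1] := mrep_osum1_unit (HG 0).
have [H' H'pd H'H] := @posdef_unit_split n H u Hpd u1.
by exists H' => // i; apply: osum1_cancel H'pd (mrep_trans H'H (HG i)).
Qed.

(** The identity of size [1 + m] is <1> plus the identity of size [m], which cancellation passes on
    to the complement; the splitting can thus be iterated. *)
Lemma posdef_split_one n m (H : 'M[int]_(1 + n)) :
  posdef H -> mrep H (1%:M : 'M_(1 + m)) ->
  exists H' : 'M[int]_n,
    [/\ posdef H', mrep (osum1 H') H & mrep H' (1%:M : 'M_m)].
Proof.
rewrite scalar_mx_block => Hpd H1; have [u u1] := mrep_osum1_unit H1.
have [H' H'pd H'H] := posdef_unit_split Hpd u1.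
by exists H'; split=> //; apply: osum1_cancel H'pd (mrep_trans H'H H1).
Qed.

(** * Obstructions in small rank *)

Lemma mrep_osum1E n m (H : 'M[int]_n) (G : 'M[int]_m) :
  mrep (osum1 H) G -> exists (a : 'I_m -> int) (K : 'M[int]_m),
    mrep H K /\ forall i j, G i j = a i * a j + K i j.
Proof.
move=> [X <-]; exists (fun i => lsubmx X i 0).
exists (rsubmx X *m H *m (rsubmx X)^T); split; first by exists (rsubmx X).
move=> i j; rewrite -[X in LHS]hsubmxK osum1_mul mxE; congr (_ + _).
by rewrite mxE big_ord1 [X in _ * X]mxE.
Qed.

Lemma mrep_dim1E m (H : 'M[int]_1) (K : 'M[int]_m) :
  mrep H K -> exists z : 'I_m -> int, forall i j, K i j = H 0 0 * (z i * z j).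
Proof.
move=> [X <-]; exists (fun i => X i 0) => i j.
by rewrite !(mxE, big_ord1) mulrAC mulrC.
Qed.

Lemma mrep_dim0E m (H : 'M[int]_0) (K : 'M[int]_m) : mrep H K -> K = 0.
Proof. by move=> [X <-]; rewrite [X]thinmx0 !mul0mx. Qed.

Lemma posdef_dim1 (H : 'M[int]_1) : posdef H -> 0 < H 0 0.
Proof.
move=> [_ /(_ 1%:M)]; rewrite mul1mx trmx1 mulmx1; apply.
exact: oner_neq0.
Qed.

Lemma sqr_le3 (x : int) : x * x <= 3 -> x = -1 \/ x = 0 \/ x = 1.
Proof.
move=> x3; have [] : -1 <= x /\ x <= 1 by split; nia.
lia.
Qed.

Lemma sqr_le8 (x : int) : x * x <= 8 -> x = -2 \/ x = -1 \/ x = 0 \/ x = 1 \/ x = 2.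
Proof.
move=> x3; have [] : -2 <= x /\ x <= 2 by split; nia.
lia.
Qed.

(** Representing 2 forces [d] to be 1 or 2, and 7 is neither a sum of two squares nor of the form
    z^2 + 2t^2. The bounds on squares make this a finite check. *)
Lemma no_binary_1_2_7 (d x y z t : int) : 0 < d ->
  2 = x * x + d * (y * y) -> 7 = z * z + d * (t * t) -> False.
Proof.
move=> d0 xy zt.
have xP : x * x <= 3 by nia.
have zP : z * z <= 8 by nia.
have tP : t * t <= 8 by nia.
have [xE|[xE|xE]] := sqr_le3 xP.
all: try have yP : y * y <= 3 by nia.
all: have [yE|[yE|yE]] := sqr_le3 yP.
all: have [zE|[zE|[zE|[zE|zE]]]] := sqr_le8 zP.
all: have [tE|[tE|[tE|[tE|tE]]]] := sqr_le8 tP.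
all: subst; lia.
Qed.

(** As 3 is not a sum of two squares, [z] and [z'] are nonzero, hence 1 or -1, and d = 3 - a^2 - b^2
    is 1, 2 or 3. The product of the two vectors is then odd if d = 1; otherwise its last term, 2 or
    3 in absolute value, exceeds the rest. *)
Lemma no_ternary_1_1_d_3_3 (d a b z a' b' z' : int) : 0 < d ->
  3 = a * a + (b * b + d * (z * z)) -> 3 = a' * a' + (b' * b' + d * (z' * z')) ->
  0 = a * a' + (b * b' + d * (z * z')) -> False.
Proof.
move=> d0 e1 e2 e3.
have aP : a * a <= 3 by nia.
have bP : b * b <= 3 by nia.
have zP : z * z <= 3 by nia.
have aP' : a' * a' <= 3 by nia.
have bP' : b' * b' <= 3 by nia.
have zP' : z' * z' <= 3 by nia.
have [aE|[aE|aE]] := sqr_le3 aP;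
have [bE|[bE|bE]] := sqr_le3 bP;
have [zE|[zE|zE]] := sqr_le3 zP; subst; try lia;
have [aE|[aE|aE]] := sqr_le3 aP';
have [bE|[bE|bE]] := sqr_le3 bP';
have [zE|[zE|zE]] := sqr_le3 zP'; subst; lia.
Qed.

(** For n = 2 this is the lower bound in kappa(1, 2) = 2. *)
Lemma mx_simul_diag n : mx_simul 1 n n.
Proof.
move=> G Gpd; exists (diag_mx (\row_i G i 0 0)) => [|i].
  by apply: diag_posdef => i; rewrite mxE; apply: posdef_dim1.
exists (delta_mx 0 i); rewrite trmx_delta -rowE -colE.
by apply/matrixP=> j k; rewrite !ord1 !mxE eqxx.
Qed.

Lemma not_mx_simul11 : ~ mx_simul 1 1 2.
Proof.
move=> mxS; have [|H Hpd HG] := mxS (fun i => (i.+1%:Z)%:M).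
  by move=> i; apply: scalar_posdef.
have [H' [_ H'H _]] := @posdef_split_one 0 0 H Hpd (HG ord0).
(* The complement has rank 0, so 2 would be a square. *)
have [a [K [/mrep_dim0E-> aK]]] := mrep_osum1E (mrep_trans H'H (HG ord_max)).
move: (aK 0 0); rewrite !mxE /= addr0; move: (a 0) => x x2.
have xP : x * x <= 3 by lia.
by have [xE|[xE|xE]] := sqr_le3 xP; subst; lia.
Qed.

Lemma not_mx_simul12 : ~ mx_simul 1 2 3.
Proof.
move=> mxS; have [|H Hpd HG] := mxS (fun i => (nth 0 [:: 1; 2; 7] i)%:M).
  by case=> [[|[|[|//]]] ?]; apply: scalar_posdef.
have [H' [H'pd H'H _]] := @posdef_split_one 1 0 H Hpd (HG ord0).
have rep i := mrep_osum1E (mrep_trans H'H (HG i)).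
have [a [K [/mrep_dim1E[y yE] aK]]] := rep (Ordinal (isT : 1 < 3)%N).
have [b [L [/mrep_dim1E[z zE] bL]]] := rep (Ordinal (isT : 2 < 3)%N).
apply: (no_binary_1_2_7 (posdef_dim1 H'pd)).
  by have := aK 0 0; rewrite yE mxE; apply.
by have := bL 0 0; rewrite zE mxE; apply.
Qed.

Lemma not_mx_simul23 : ~ mx_simul 2 3 2.
Proof.
move=> mxS; have [|H Hpd HG] := mxS (fun i => (nth 0 [:: 1; 3] i)%:M).
  by case=> [[|[|//]] ?]; apply: scalar_posdef.
(* Splitting twice along <1, 1> brings [H] to the form <1, 1, d>. *)
have [H1 [H1pd H1H H11]] := @posdef_split_one 2 1 H Hpd (HG ord0).
have [H2 [H2pd H2H _]] := @posdef_split_one 1 0 H1 H1pd H11.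
have [a [K [KP aK]]] := mrep_osum1E (mrep_trans H1H (HG ord_max)).
have [b [L [/mrep_dim1E[z zE] bL]]] := mrep_osum1E (mrep_trans H2H KP).
have aE i j : (3%:M : 'M[int]_2) i j =
    a i * a j + (b i * b j + H2 0 0 * (z i * z j)).
  by rewrite -zE -bL -aK.
apply: (no_ternary_1_1_d_3_3 (posdef_dim1 H2pd)).
- by have := aE 0 0; rewrite mxE; apply.
- by have := aE 1 1; rewrite mxE; apply.
- by have := aE 0 1; rewrite mxE; apply.
Qed.

(** * From the sets S(m, n) to kappa *)

Lemma u_Z_simul m n k : (u_Z m <= (n%:Z)%:E)%E -> mx_simul m n k.
Proof.
rewrite /u_Z; case: xgetP => [_ -> [r [[L <- Luniv] _] <-]|_ //].
rewrite lee_fin lez_nat => rn; apply: mx_simul_leq rn _.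
exact/simulP/universal_simul.
Qed.

(** Both branches of [kappa] agree with the supremum of S(m, n): the test on [u_Z] succeeds only if
    S(m, n) contains every k, and when S(m, n) has no maximum [xget] falls back on its default
    +oo. *)
Lemma kappa_cases m n :
  (kappa m n = +oo%E /\ forall k, mx_simul m n k) \/
  exists k, [/\ kappa m n = (k%:Z)%:E, mx_simul m n k & ~ mx_simul m n k.+1].
Proof.
have [Sall|nSall] := pselect (forall k, mx_simul m n k).
  left; split=> //; rewrite /kappa; case: asboolP => // _.
  apply: xgetPN => _ [k [_ kmax] _].
  by have := kmax k.+1 ((simulP _ _ _).2 (Sall _)); rewrite ltnn.
(* Otherwise induction from 0 must break down at some [k], which is the maximum because S(m, n) is
   an initial segment. *)
right; have [k Sk nSk] : exists2 k, mx_simul m n k & ~ mx_simul m n k.+1.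
  apply: contrapT => noK; apply: nSall; elim=> [|k Sk]; first exact: mx_simul0.
  by apply: contrapT => nSk; apply: noK; exists k.
exists k; split=> //; rewrite /kappa; case: asboolP => [un|_].
  by case: nSk; apply: u_Z_simul.
have maxE j : simultaneously_representable m n j -> (j <= k)%N.
  rewrite leqNgt => /simulP Sj; apply/negP => kj; apply: nSk.
  exact: mx_simul_geq Sj.
apply: xget_subset1; first by exists k => //; split; first exact/simulP.
move=> _ _ [i [Si imax] <-] [j [Sj jmax] <-].
suff -> : i = j by [].
by apply/eqP; rewrite eqn_leq imax ?jmax.
Qed.

Lemma kappa_fin m n k :
  mx_simul m n k -> ~ mx_simul m n k.+1 -> kappa m n = (k%:Z)%:E.
Proof.
move=> Sk nSk; have [[_ Sall]|[j [-> Sj nSj]]] := kappa_cases m n.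
  by case: nSk; apply: Sall.
suff -> : k = j by [].
apply/eqP; rewrite eqn_leq.
by apply/andP; split; rewrite leqNgt; apply/negP => lt; [apply: nSj|apply: nSk];
  apply: mx_simul_geq lt _.
Qed.

Lemma kappa_le m n m' n' :
  (forall k, mx_simul m n k -> mx_simul m' n' k) -> (kappa m n <= kappa m' n')%E.
Proof.
move=> sub; have [[-> _]|[k' [-> _ nSk']]] := kappa_cases m' n'; first exact: leey.
have [[_ Sall]|[k [-> Sk _]]] := kappa_cases m n.
  by case: nSk'; apply/sub/Sall.
rewrite lee_fin lez_nat leqNgt; apply/negP => lt.
by apply/nSk'/sub; apply: mx_simul_geq lt _.
Qed.

Lemma mx_simul_subn d m n k : mx_simul (d + m) (d + n) k -> mx_simul m n k.
Proof. by elim: d => // d IHd; rewrite !addSn => /mx_simul_pred/IHd. Qed.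

Theorem theorem2p1 :
  (forall m : nat, (0 < m)%N -> kappa m m = 1%:E) /\
  (forall m n : nat, (0 < m)%N -> (m <= n)%N ->
     (kappa m.+1 n.+1 <= kappa m n)%E /\ (kappa m n <= kappa m n.+1)%E) /\
  (kappa 1 2 = 2%:E /\
   (forall m : nat, (2 <= m)%N -> kappa m m.+1 = 1%:E)).
Proof.
split=> [m m0|]; last split=> [m n _ _|]; last split=> [|m m2].
- apply: (@kappa_fin _ _ 1); first exact: mx_simul1.
  (* Descent by m - 1 steps, from (m, m) to (1, 1). *)
  by move: m0 => /subnK<- Sm; apply: not_mx_simul11; apply: mx_simul_subn Sm.
- split; apply: kappa_le => k; [exact: mx_simul_pred|exact: mx_simulS].
- exact: kappa_fin (@mx_simul_diag 2) not_mx_simul12.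
- apply: (@kappa_fin _ _ 1); first exact/mx_simulS/mx_simul1.
  (* Descent by m - 2 steps, from (m, m + 1) to (2, 3). *)
  move: m2 => /subnK<-; rewrite -addnS => Sm.
  by apply: not_mx_simul23; apply: mx_simul_subn Sm.
Qed.
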